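(* Let $\lambda$ be a real number, $\alpha>0$, and let $X$ be a degenerate Poisson random variable with parameter $\alpha$. Then for every integer $n\ge0$, $$E\bigg[\binom{X+n-1}{n}\bigg]=\frac{1}{n!}B^{L}_{n,\lambda}(\alpha),$$ where $B^L_{n,\lambda}$ are the degenerate Lah-Bell polynomials.
   Context: The $\lambda$-falling factorial is $(x)_{0,\lambda}=1$, $(x)_{n,\lambda}=x(x-\lambda)\cdots(x-(n-1)\lambda)$ for $n\ge1$. The degenerate exponential is $e_\lambda^x(t)=\sum_{n\ge0}(x)_{n,\lambda}\frac{t^n}{n!}$ $(=(1+\lambda t)^{x/\lambda})$, $e_\lambda(t)=e_\lambda^1(t)$, $e_\lambda^{-1}(x)=1/e_\lambda(x)$ (for $\lambda=0$: $e^{xt}$). A degenerate Poisson random variable with parameter $\alpha>0$ is a random variable $X$ with $P\{X=i\}=e_\lambda^{-1}(\alpha)\frac{\alpha^i}{i!}(1)_{i,\lambda}$ for $i=0,1,2,\dots$. The degenerate Lah-Bell polynomials are defined by $e_\lambda^{-1}(x)\,e_\lambda\!\big(\frac{x}{1-t}\big)=\sum_{n\ge0}B^L_{n,\lambda}(x)\frac{t^n}{n!}$. Here $\binom{X+n-1}{n}=\frac{X(X+1)\cdots(X+n-1)}{n!}$ (equal to $1$ for $n=0$). *)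

(* Defs.v *)
From HB Require Import structures.
From mathcomp Require Import all_boot all_order all_algebra.
From mathcomp Require Import all_classical all_reals all_analysis.
Set Implicit Arguments.
Unset Strict Implicit.
Unset Printing Implicit Defensive.
Import Order.TTheory GRing.Theory Num.Theory.
Import numFieldNormedType.Exports.
Local Open Scope classical_set_scope.
Local Open Scope ring_scope.

Definition lambda_ffact (R : realType) (lam x : R) (n : nat) : R :=
  \prod_(j < n) (x - j%:R * lam).

(* e_lam^x(t); the limit has a meaningful value only where the series
   converges. *)
Definition degenerate_exp (R : realType) (lam x t : R) : R :=
  limn (series (fun n => lambda_ffact lam x n * (t ^+ n / n`!%:R))).

Definition degenerate_poisson (d : measure_display) (T : measurableType d)
    (R : realType) (P : probability T R) (lam alpha : R)
    (X : {RV P >-> nat}) : Prop :=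
  forall i : nat,
    P (X @^-1` [set i]) =
    ((degenerate_exp lam 1 alpha)^-1 * (alpha ^+ i / i`!%:R)
       * lambda_ffact lam 1 i)%:E.

(* The generating function is expanded in t at a fixed real x: its
   coefficients are in general not polynomial in x, but rational functions
   such as x / (1 + lam * x) for n = 1. *)
Definition lah_bell_gf (R : realType) (lam x : R) (b : nat -> R) : Prop :=
  \forall t \near (0 : R),
    series (fun n => b n * (t ^+ n / n`!%:R)) @ \oo -->
      (degenerate_exp lam 1 x)^-1 * degenerate_exp lam 1 (x / (1 - t)).

(* A sequence of Taylor coefficients is unique when it exists, so the choice
   made by get is immaterial. *)
Definition degenerate_lah_bell (R : realType) (lam : R) (n : nat) (x : R) : R :=
  (get [set b : nat -> R | lah_bell_gf lam x b]) n.

(* The binomial coefficient "x + n - 1 choose n" for real x. *)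
Definition rising_binomial (R : realType) (x : R) (n : nat) : R :=
  (\prod_(j < n) (x + j%:R)) / n`!%:R.

(* Main.v *)
(** Writing p_i = P(X = i), the negative binomial series
    sum_n C(i+n-1, n) t^n = (1-t)^(-i) and an exchange of sum and expectation
    give sum_n E[C(X+n-1, n)] t^n = sum_i p_i (1-t)^(-i)
    = e_lam(alpha)^(-1) e_lam(alpha / (1-t)) near t = 0, and Taylor
    coefficients are unique.  The exchange needs sum_i p_i (1-r)^(-i) to
    converge for some r > 0.  This follows from the mere existence of X: it
    forces p_i >= 0 and the convergence of sum_i p_i.  As
    p_(i+1) / p_i = alpha (1 - i lam) / (i+1), convergence excludes
    - alpha lam >= 1, so that the ratios are eventually below some q < 1. *)
Require Import Defs.
From HB Require Import structures.
From mathcomp Require Import all_boot all_order all_algebra.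
From mathcomp Require Import all_classical all_reals all_analysis.
From mathcomp Require Import measurable_realfun ring lra.
Set Implicit Arguments.
Unset Strict Implicit.
Unset Printing Implicit Defensive.
Import Order.TTheory GRing.Theory Num.Theory.
Import numFieldNormedType.Exports.
Local Open Scope classical_set_scope.
Local Open Scope ring_scope.

(** * Uniqueness of power series coefficients *)

Lemma geometric_sum_le2 (R : realFieldType) (x : R) (N : nat) :
  0 <= x -> x <= 2^-1 -> \sum_(k < N) x ^+ k <= 2.
Proof.
move=> x0 x2; elim: N => [|N IHN]; first by rewrite big_ord0.
rewrite big_ord_recl expr0 /bump/=.
under eq_bigr do rewrite exprS.
rewrite -mulr_sumr.
have : x * \sum_(i < N) x ^+ i <= 2^-1 * 2.
  by rewrite ler_pM// sumr_ge0// => i _; exact: exprn_ge0.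
by lra.
Qed.

Lemma power_series_coef0_eq0 (R : realType) (e : R ^nat) (r : R) : 0 < r ->
  (forall t, 0 < t <= r -> series (fun n => e n * t ^+ n) @ \oo --> (0 : R)) ->
  e 0%N = 0.
Proof.
move=> r0 cvg_e.
have : series (fun n => e n * r ^+ n) @ \oo --> (0 : R).
  by apply: cvg_e; rewrite r0 lexx.
(* Convergence at [t = r] makes the terms tend to 0, hence bounded; every number above [M] is a
   bound, in particular [M + 1]. *)
move=> /cvgP/cvg_series_cvg_0/cvgP/cvg_seq_bounded.
move=> [M [_ /(_ _ (ltr_pwDr ltr01 (lexx _))) eM]].
set K := M + 1 in eM.
have {}eM n : `|e n * r ^+ n| <= K by exact: eM.
have K0 : 0 <= K by exact: le_trans (eM 0%N).
(* |e_0| is at most the geometric bound on the tail, which is O(t). *)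
have bound t : 0 < t <= r / 2 -> `|e 0%N| <= K * (t / r) * 2.
  move=> /andP[t0 tr]; set x := t / r.
  have x0 : 0 < x by rewrite divr_gt0.
  have x2 : x <= 2^-1 by rewrite ler_pdivrMr// mulrC.
  have tr' : t <= r by lra.
  have := cvg_e t; rewrite t0 tr' => /(_ isT) /cvg_norm; rewrite normr0 => cvg0.
  rewrite -subr_le0 -(cvg_lim _ cvg0)//.
  apply: limr_ge; first exact: (cvgP _ cvg0).
  (* The empty partial sum lacks [e 0], so the estimate starts at index 1. *)
  exists 1%N => // -[//|N] _ /=.
  rewrite /series/= big_mkord big_ord_recl expr0 mulr1 lerBlDr.
  set s := \sum_(i < N) _.
  have tail : `|s| <= K * x * 2.
    apply: le_trans (ler_norm_sum _ _ _) _.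
    apply: (@le_trans _ _ (\sum_(k < N) K * x * x ^+ k)).
      apply: ler_sum => k _; rewrite -mulrA -exprS /bump/= ?add1n.
      have -> : e k.+1 * t ^+ k.+1 = e k.+1 * r ^+ k.+1 * x ^+ k.+1.
        by rewrite -mulrA -exprMn [r * x]mulrC /x divfK// gt_eqF.
      rewrite normrM (ger0_norm (exprn_ge0 _ (ltW x0))).
      by rewrite ler_wpM2r// exprn_ge0// ltW.
    rewrite -mulr_sumr ler_wpM2l//; first by rewrite mulr_ge0// ltW.
    by apply: geometric_sum_le2 => //; exact: ltW.
  apply: le_trans (lerD (lexx _) tail).
  by rewrite -{1}(addrK s (e 0%N)); exact: ler_normB.
apply/eqP; rewrite -normr_le0; apply/ler_addgt0Pl => eps eps0; rewrite addr0.
have Ke0 : 0 < K + eps by rewrite ltr_wpDl.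
(* This [t] is at most [r / 2] and turns the bound into [K / (K + eps) * eps]; adding [eps] keeps
   the denominator positive when [K = 0]. *)
apply: (le_trans (bound (r / 2 * (eps / (K + eps))) _)).
  rewrite !mulr_gt0 ?invr_gt0//= ger_pMr ?divr_gt0//.
  by rewrite ler_pdivrMr// mul1r lerDr.
rewrite (_ : K * _ * 2 = K / (K + eps) * eps); last by field; rewrite !gt_eqF.
by rewrite ger_pMl// ler_pdivrMr// mul1r lerDl ltW.
Qed.

(** Once [e 0 = 0], dividing by [t > 0] leaves a series with the shifted coefficients and again sum
    0, so induction on [n], for all [e] at once, applies. *)
Lemma power_series_eq0 (R : realType) (e : R ^nat) (r : R) : 0 < r ->
  (forall t, 0 < t <= r -> series (fun n => e n * t ^+ n) @ \oo --> (0 : R)) ->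
  forall n, e n = 0.
Proof.
move=> r0 cvg_e n; elim: n e cvg_e => [|n IHn] e cvg_e.
  exact: power_series_coef0_eq0 r0 cvg_e.
apply: (IHn (fun k => e k.+1)) => t /[dup] /andP[t0 _] /cvg_e.
have e0 := power_series_coef0_eq0 r0 cvg_e.
rewrite -cvg_shiftS => cvg_t.
rewrite (_ : series _ =
    (fun N => t^-1 * series (fun n => e n * t ^+ n) N.+1)).
  by rewrite -[X in _ --> X](mulr0 t^-1); exact: cvgMl_tmp.
apply/funext => N.
rewrite /series/= !big_mkord big_ord_recl e0 mul0r add0r mulr_sumr.
apply: eq_bigr => k _; rewrite /bump/= exprS.
by field; rewrite gt_eqF.
Qed.

(** * Rising binomials and the negative binomial series *)

Lemma rising_binomial0 (R : realType) (x : R) : rising_binomial x 0 = 1.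
Proof. by rewrite /rising_binomial big_ord0 divr1. Qed.

Lemma rising_binomial_0S (R : realType) (n : nat) :
  rising_binomial (0 : R) n.+1 = 0.
Proof. by rewrite /rising_binomial big_ord_recl addr0 !mul0r. Qed.

Lemma rising_binomial_ge0 (R : realType) (x : R) (n : nat) :
  0 <= x -> 0 <= rising_binomial x n.
Proof.
by move=> x0; rewrite divr_ge0// prodr_ge0// => i _; rewrite addr_ge0.
Qed.

(** Pascal's rule: the three products share the factors [x + 1], ..., [x + n]. *)
Lemma rising_binomialS (R : realType) (x : R) (n : nat) :
  rising_binomial (x + 1) n.+1 =
  rising_binomial (x + 1) n + rising_binomial x n.+1.
Proof.
rewrite /rising_binomial big_ord_recr [in RHS]big_ord_recl/=.
have -> : \prod_(i < n) (x + (bump 0 i)%:R) = \prod_(i < n) (x + 1 + i%:R).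
  by apply: eq_bigr => i _; rewrite /bump/= natrD addrA.
rewrite factS natrM addr0.
have n0 : n`!%:R != 0 :> R by rewrite pnatr_eq0 -lt0n fact_gt0.
have n1 : n.+1%:R != 0 :> R by rewrite pnatr_eq0.
by move: n1; rewrite -natr1 => n1; field; rewrite n0 n1.
Qed.

(** Partial sums of the expansion of [(1 - t) ^- i]. *)
Definition negbin_series (R : realType) (i : nat) (t : R) : R ^nat :=
  series (fun n => rising_binomial i%:R n * t ^+ n).

Lemma negbin_series0 (R : realType) (t : R) (N : nat) :
  negbin_series 0 t N.+1 = 1.
Proof.
rewrite /negbin_series/series/= big_mkord big_ord_recl rising_binomial0 mulr1.
by rewrite big1 ?addr0// => i _; rewrite rising_binomial_0S mul0r.
Qed.

(** By Pascal's rule, multiplying by [1 - t] lowers [i] by one, up to a boundary term. Both the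
    bound and the limit of the partial sums follow from this by induction on [i]. *)
Lemma negbin_seriesS (R : realType) (i N : nat) (t : R) :
  (1 - t) * negbin_series i.+1 t N.+1 =
  negbin_series i t N.+1 - rising_binomial i.+1%:R N * t ^+ N.+1.
Proof.
elim: N => [|N IHN].
  rewrite /negbin_series/series/= !big_nat1 !rising_binomial0.
  by rewrite expr0 expr1 !mulr1 mul1r.
rewrite /negbin_series seriesSr mulrDr [in RHS]seriesSr.
rewrite -!/(negbin_series _ _) IHN.
rewrite -[i.+1%:R]natr1 rising_binomialS.
rewrite !exprS; ring.
Qed.

Lemma negbin_series_le (R : realType) (i N : nat) (t : R) :
  0 <= t -> t < 1 -> negbin_series i t N <= (1 - t) ^- i.
Proof.
move=> t0 t1; have ht : 0 < 1 - t by rewrite subr_gt0.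
case: N => [|N].
  by rewrite /negbin_series/series/= big_geq// invr_ge0 exprn_ge0// ltW.
elim: i => [|i IHi]; first by rewrite negbin_series0 expr0 invr1.
rewrite exprS invfM ler_pdivlMl// negbin_seriesS.
rewrite (le_trans _ IHi)// gerBl mulr_ge0 ?exprn_ge0//.
exact: rising_binomial_ge0.
Qed.

Lemma norm_negbin_series_le (R : realType) (i N : nat) (t : R) :
  `|t| < 1 -> `|negbin_series i t N| <= (1 - `|t|) ^- i.
Proof.
move=> t1; rewrite (le_trans _ (negbin_series_le i N _ t1))//.
rewrite (le_trans (ler_norm_sum _ _ _))// ler_sum// => n _.
by rewrite normrM normrX ger0_norm// rising_binomial_ge0.
Qed.

(** Induction on [i] by the recursion. The boundary term vanishes in the limit: it is [t] times the
    general term of a series whose absolute partial sums are bounded. *)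
Lemma cvg_negbin_series (R : realType) (i : nat) (t : R) : `|t| < 1 ->
  negbin_series i t @ \oo --> (1 - t) ^- i.
Proof.
move=> t1; have ht : 1 - t != 0.
  by rewrite subr_eq0 eq_sym lt_eqF// (le_lt_trans (ler_norm _)).
elim: i => [|i IHi].
  rewrite expr0 invr1 -cvg_shiftS.
  by under eq_fun do rewrite negbin_series0; exact: cvg_cst.
have term0 :
    (fun n => rising_binomial (i.+1%:R : R) n * t ^+ n) @ \oo --> (0 : R).
  apply: cvg_series_cvg_0; apply: normed_cvg.
  apply: nondecreasing_is_cvgn.
    by apply: nondecreasing_series => n _ _; exact: normr_ge0.
  exists ((1 - `|t|) ^- i.+1) => _ [N _ <-].
  rewrite (le_trans _ (negbin_series_le i.+1 N _ t1))//.
  rewrite /negbin_series/series/= ler_sum// => n _.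
  by rewrite normrM normrX ger0_norm// rising_binomial_ge0.
rewrite -cvg_shiftS.
have -> : (fun n => negbin_series i.+1 t n.+1) =
   (fun N => (1 - t)^-1 * (negbin_series i t N.+1 -
        t * (rising_binomial i.+1%:R N * t ^+ N))).
  apply/funext => N; rewrite mulrCA -exprS -negbin_seriesS.
  by rewrite mulKf.
have -> : (1 - t) ^- i.+1 = (1 - t)^-1 * ((1 - t) ^- i - t * 0).
  by rewrite mulr0 subr0 exprS invfM.
apply: cvgMl_tmp; apply: cvgB; last exact: cvgMl_tmp.
by rewrite (cvg_shiftS (negbin_series i t)).
Qed.

(** * Expectations of functions of an integer-valued random variable *)

Section nat_rv.
Context d (T : measurableType d) (R : realType) (P : probability T R).
Variables (X : {RV P >-> nat}) (p : nat -> R).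
Hypothesis pX : forall i, P (X @^-1` [set i]) = (p i)%:E.

Lemma measurable_nat_rv_comp (f : nat -> R) :
  measurable_fun setT (fun w => (f (X w))%:E).
Proof.
apply/measurable_EFinP.
by apply: (@measurableT_comp _ _ _ _ _ _ f) => //; exact: measurable_funPT.
Qed.

Lemma nat_rv_prob_ge0 i : 0 <= p i.
Proof. by rewrite -lee_fin -pX. Qed.

(** The fibres of [X] partition the space, and on the fibre over [i], of mass [p i], the integrand
    is constant. *)
Lemma integral_nat_rv (f : nat -> R) : (forall i, 0 <= f i) ->
  (\int[P]_w (f (X w))%:E = \sum_(0 <= i <oo) (p i * f i)%:E)%E.
Proof.
move=> f0.
have XT : \bigcup_i (X @^-1` [set i]) = setT.
  by rewrite -preimage_bigcup; apply/seteqP; split => w //= _; exists (X w).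
have mX i : measurable (X @^-1` [set i]).
  by rewrite -[X in measurable X]setTI; exact: measurable_funPT.
rewrite -XT ge0_integral_bigcup//.
- apply: eq_eseriesr => i _.
  under eq_integral => w /[!inE]/= -> do over.
  by rewrite integral_cst//= [p i * _]mulrC EFinM; congr (_ * _)%E; exact: pX.
- by rewrite XT; exact: measurable_nat_rv_comp.
- by move=> w _; rewrite lee_fin.
- by apply/trivIsetP => i j _ _ /eqP ij; apply/seteqP; split => w //= [-> /ij].
Qed.

Lemma integral_nat_rv_lim (f : nat -> R) : (forall i, 0 <= f i) ->
  cvgn (series (fun i => p i * f i)) ->
  (\int[P]_w (f (X w))%:E = (limn (series (fun i => p i * f i)))%:E)%E.
Proof.
move=> f0 cvgf; rewrite integral_nat_rv// -EFin_lim//; congr (limn _).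
by apply/funext => n /=; rewrite sumEFin.
Qed.

Lemma integrable_nat_rv (f : nat -> R) : (forall i, 0 <= f i) ->
  cvgn (series (fun i => p i * f i)) ->
  P.-integrable setT (fun w => (f (X w))%:E).
Proof.
move=> f0 cvgf; apply/integrableP; split; first exact: measurable_nat_rv_comp.
under eq_integral do rewrite gee0_abs ?lee_fin//.
by rewrite integral_nat_rv_lim// ltry.
Qed.

End nat_rv.

(** * Generating function of the rising binomial moments *)

Lemma geometric_weight_cvg (R : realType) (p : R ^nat) (r t : R) :
  (forall i, 0 <= p i) -> r < 1 -> `|t| <= r ->
  cvgn (series (fun i => p i * (1 - r) ^- i)) ->
  cvgn (series (fun i => p i * (1 - t) ^- i)).
Proof.
move=> p0 r1 tr cvg_p; have tr' : t <= r := le_trans (ler_norm t) tr.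
apply: series_le_cvg cvg_p => i.
- by rewrite mulr_ge0// invr_ge0 exprn_ge0//; lra.
- by rewrite mulr_ge0// invr_ge0 exprn_ge0//; lra.
- rewrite ler_wpM2l// lef_pV2 ?posrE ?exprn_gt0//; [|lra..].
  by rewrite lerXn2r ?nnegrE; lra.
Qed.

Section rising_binomial_moments.
Context d (T : measurableType d) (R : realType) (P : probability T R).
Variables (X : {RV P >-> nat}) (p : nat -> R).
Hypothesis pX : forall i, P (X @^-1` [set i]) = (p i)%:E.

Let p0 i : 0 <= p i. Proof. exact: (nat_rv_prob_ge0 pX). Qed.

(** A single term of the negative binomial series at [r] is at most its sum, so the rising binomial
    is at most [r ^- n * (1 - r) ^- i]. *)
Lemma rising_binomial_moment_cvg (r : R) (n : nat) : 0 < r < 1 ->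
  cvgn (series (fun i => p i * (1 - r) ^- i)) ->
  cvgn (series (fun i => p i * rising_binomial (i%:R : R) n)).
Proof.
move=> /andP[r0 r1] cvg_p.
have h0 i : 0 <= rising_binomial (i%:R : R) n by exact: rising_binomial_ge0.
apply: (@series_le_cvg _ _ (fun i => r ^- n * (p i * (1 - r) ^- i))).
- by move=> i; rewrite mulr_ge0.
- by move=> i; rewrite !mulr_ge0// ?invr_ge0 ?exprn_ge0//; lra.
- move=> i; rewrite ler_pdivlMl ?exprn_gt0// mulrCA ler_wpM2l//.
  apply: le_trans (negbin_series_le i n.+1 (ltW r0) r1).
  rewrite /negbin_series seriesSr mulrC lerDr sumr_ge0// => k _.
  by rewrite mulr_ge0 ?exprn_ge0 ?rising_binomial_ge0// ltW.
- exact: is_cvg_seriesZ.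
Qed.

Definition rising_binomial_moment (n : nat) : R :=
  limn (series (fun i => p i * rising_binomial (i%:R : R) n)).

Lemma integral_rising_binomial (r : R) (n : nat) : 0 < r < 1 ->
  cvgn (series (fun i => p i * (1 - r) ^- i)) ->
  (\int[P]_w (rising_binomial ((X w)%:R : R) n)%:E =
   (rising_binomial_moment n)%:E)%E.
Proof.
move=> r01 cvg_p.
apply: (integral_nat_rv_lim pX (f := fun i => rising_binomial (i%:R : R) n)).
  by move=> i; exact: rising_binomial_ge0.
exact: rising_binomial_moment_cvg r01 cvg_p.
Qed.

(** Dominated convergence: the partial sums are the expectations of [negbin_series (X w) t N], which
    tends pointwise to [(1 - t) ^- X w] and is dominated by the integrable [(1 - r) ^- X w]. *)
Lemma rising_binomial_moment_gf (r t : R) : 0 < r < 1 -> `|t| <= r ->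
  cvgn (series (fun i => p i * (1 - r) ^- i)) ->
  series (fun n => rising_binomial_moment n * t ^+ n) @ \oo -->
    limn (series (fun i => p i * (1 - t) ^- i)).
Proof.
move=> r01 tr cvg_p; have /andP[r0 r1] := r01.
have tr' : t <= r := le_trans (ler_norm t) tr.
have nt1 : `|t| < 1 := le_lt_trans tr r1.
have ge0 (s : R) : s < 1 -> forall i, 0 <= (1 - s) ^- i.
  by move=> s1 i; rewrite invr_ge0 exprn_ge0//; lra.
have t1 : t < 1 by lra.
have := geometric_weight_cvg p0 r1 tr cvg_p.
move/(integral_nat_rv_lim pX (ge0 t t1)) => int_t.
have int_N N : (\int[P]_w (negbin_series (X w) t N)%:E =
    (series (fun n => rising_binomial_moment n * t ^+ n) N)%:E)%E.
  under eq_integral do rewrite -sumEFin.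
  rewrite integral_sum//.
    rewrite /series/= -sumEFin; apply: eq_bigr => n _.
    under eq_integral do rewrite EFinM muleC.
    rewrite integralZl//.
      by rewrite (integral_rising_binomial _ r01 cvg_p) -EFinM mulrC.
    apply: (integrable_nat_rv pX (f := fun i => rising_binomial (i%:R : R) n)).
      by move=> i; exact: rising_binomial_ge0.
    exact: rising_binomial_moment_cvg r01 cvg_p.
  move=> n; under eq_fun do rewrite EFinM muleC.
  apply: integrableZl => //.
  apply: (integrable_nat_rv pX (f := fun i => rising_binomial (i%:R : R) n)).
    by move=> i; exact: rising_binomial_ge0.
  exact: rising_binomial_moment_cvg r01 cvg_p.
have : (\int[P]_w (negbin_series (X w) t N)%:E)%E @[N --> \oo] -->
    (\int[P]_w ((1 - t) ^- X w)%:E)%E.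
  apply: (@dominated_cvg _ _ _ _ _ _ _ _
    (fun w => ((1 - r) ^- X w)%:E)) => //.
  - move=> N.
    exact: (measurable_nat_rv_comp X (fun i => negbin_series i t N)).
  - move=> w _; apply: cvg_EFin; first exact: nearW.
    exact: cvg_negbin_series.
  - exact: (integrable_nat_rv pX (ge0 r r1)).
  - move=> N w _; rewrite abse_EFin lee_fin.
    apply: le_trans (norm_negbin_series_le _ _ _) _; first by [].
    rewrite lef_pV2 ?posrE ?exprn_gt0//; [|lra..].
    by rewrite lerXn2r ?nnegrE; lra.
rewrite int_t; under eq_fun do rewrite int_N.
by move/fine_cvgP => [].
Qed.

End rising_binomial_moments.

(** * Geometric summability of the degenerate exponential terms *)

Lemma ratio_test_le (R : realType) (b : R ^nat) (x : R) (K : nat) :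
  0 < x < 1 -> (forall i, 0 <= b i) ->
  (forall i, (K <= i)%N -> b i.+1 <= x * b i) -> cvgn (series b).
Proof.
move=> /andP[x0 x1] b0 bx.
(* These quotients are nonincreasing from [K] on, so the sum of the first [K + 1] of them bounds
   them all. *)
pose c i := b i / x ^+ i.
have c0 i : 0 <= c i by rewrite divr_ge0// exprn_ge0// ltW.
have cM i : c i <= \sum_(k < K.+1) c k.
  elim: i => [|i IHi].
    by rewrite big_ord_recl lerDl sumr_ge0.
  have [iK|Ki] := ltnP i K.
    rewrite (bigD1 (Ordinal (iK : (i.+1 < K.+1)%N)))//= lerDl.
    exact: sumr_ge0.
  apply: le_trans IHi; rewrite /c exprSr invfM mulrA ler_pdivrMr//.
  rewrite mulrAC ler_wpM2r//; last by rewrite mulrC bx.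
  by rewrite invr_ge0 exprn_ge0// ltW.
apply: (@series_le_cvg _ _ (geometric (\sum_(k < K.+1) c k) x)) => //.
- by move=> i; rewrite mulr_ge0 ?exprn_ge0 ?sumr_ge0// ltW.
- by move=> i; rewrite -ler_pdivrMr ?exprn_gt0//; exact: cM.
- by apply: is_cvg_geometric_series; rewrite gtr0_norm.
Qed.

Definition degenerate_exp_term (R : realType) (lam x : R) (i : nat) : R :=
  lambda_ffact lam 1 i * (x ^+ i / i`!%:R).

(** The ratio of consecutive terms, written without division because terms can vanish. *)
Lemma degenerate_exp_termS (R : realType) (lam x : R) (i : nat) :
  i.+1%:R * degenerate_exp_term lam x i.+1 =
  x * (1 - i%:R * lam) * degenerate_exp_term lam x i.
Proof.
rewrite /degenerate_exp_term /lambda_ffact big_ord_recr/= factS natrM exprS.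
have i0 : i`!%:R != 0 :> R by rewrite pnatr_eq0 -lt0n fact_gt0.
have i1 : i.+1%:R != 0 :> R by rewrite pnatr_eq0.
by move: i1; rewrite -natr1 => i1; field; rewrite i0 i1.
Qed.

(** The factor [x * (1 - i%:R * lam) / i.+1%:R] of the recurrence tends to [- (x * lam)]. The limit
    value 1, where the ratio test is silent, is excluded as well. *)
Lemma degenerate_exp_radius (R : realType) (lam x : R)
    (a := degenerate_exp_term lam x) :
  0 < x -> (forall i, 0 <= a i) -> cvgn (series a) -> - (x * lam) < 1.
Proof.
move=> x0 a_ge0 cvg_a.
rewrite ltNge; apply/negP => lam1.
(* i a_i is nondecreasing, so sum_i a_i dominates a harmonic series. *)
have mono i : i%:R * a i <= i.+1%:R * a i.+1.
  rewrite degenerate_exp_termS ler_wpM2r//.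
  rewrite -subr_ge0 (_ : _ - _ = x + i%:R * (- (x * lam) - 1)); last by ring.
  by rewrite addr_ge0 ?mulr_ge0 ?subr_ge0// ltW.
(* The induction starts from [a 1 = x], as [0 * a 0] gives no positive lower bound. *)
have ax i : x <= i.+1%:R * a i.+1.
  elim: i => [|i IHi]; last exact: le_trans IHi (mono _).
  rewrite degenerate_exp_termS mul0r subr0 mulr1.
  rewrite /degenerate_exp_term /lambda_ffact big_ord0 expr0.
  by rewrite !mul1r invr1 mulr1.
apply: (@dvg_harmonic R).
apply: (@series_le_cvg _ _ (fun i => x^-1 * a i.+1)).
- by move=> i; exact: harmonic_ge0.
- by move=> i; rewrite mulr_ge0// invr_ge0 ltW.
- by move=> i; rewrite /= ler_pdivlMl// ler_pdivrMr// mulrC.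
apply: is_cvg_seriesZ.
rewrite (_ : series _ = (fun N => series a N.+1 - a 0%N)).
  apply: cvgP; apply: cvgB; last exact: cvg_cst.
  by rewrite (cvg_shiftS (series a)); exact: cvg_a.
apply/funext => N.
by rewrite /series/= !big_mkord big_ord_recl addrAC subrr add0r.
Qed.

Lemma degenerate_exp_term_summable (R : realType) (lam x : R)
    (a := degenerate_exp_term lam x) :
  0 < x -> (forall i, 0 <= a i) -> cvgn (series a) ->
  exists2 r : R, 0 < r < 1 & cvgn (series (fun i => a i * (1 - r) ^- i)).
Proof.
move=> x0 a_ge0 cvg_a.
have mu1 := degenerate_exp_radius x0 a_ge0 cvg_a.
set mu := - (x * lam) in mu1.
have [q [q0 q1 muq]] : exists q : R, [/\ 0 < q, q < 1 & mu < q].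
  have [m0|m0] := leP mu 0; first by exists (2^-1); split; lra.
  by exists ((mu + 1) / 2); split; lra.
(* Then [s = 1 - r] is the midpoint of [q] and 1, so the weighted ratios are eventually at most
   [q / s < 1]. *)
exists ((1 - q) / 2); first by apply/andP; split; lra.
set s := 1 - _.
have qs : q < s by rewrite /s; lra.
have s0 : 0 < s by lra.
(* Beyond this index [x + i%:R * mu <= q * i%:R], which bounds the recurrence factor by [q]. *)
apply: (@ratio_test_le _ _ (q / s) (Num.bound (x / (q - mu)))).
- by rewrite divr_gt0//= ltr_pdivrMr// mul1r.
- by move=> i; rewrite mulr_ge0// invr_ge0 exprn_ge0// ltW.
move=> i Ki.
have -> : q / s * (a i / s ^+ i) = q * a i / s ^+ i.+1.
  by rewrite exprS invfM; ring.
rewrite ler_pM2r ?invr_gt0 ?exprn_gt0//.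
rewrite -(@ler_pM2l _ i.+1%:R)// degenerate_exp_termS [leRHS]mulrA ler_wpM2r//.
have : x / (q - mu) <= i%:R.
  apply: ltW; apply: lt_le_trans (archi_boundP _) _; last by rewrite ler_nat.
  by rewrite divr_ge0; lra.
rewrite ler_pdivrMr ?subr_gt0// /mu -natr1; nra.
Qed.

(** * Identification of the Taylor coefficients and conclusion *)

Lemma nat_rv_prob_sum d (T : measurableType d) (R : realType)
    (P : probability T R) (X : {RV P >-> nat}) (p : nat -> R) :
  (forall i, P (X @^-1` [set i]) = (p i)%:E) ->
  (\sum_(0 <= i <oo) (p i)%:E = 1)%E.
Proof.
move=> pX; have := integral_nat_rv pX (f := fun=> 1) (fun=> ler01).
have -> : (\int[P]_w (1 : R)%:E = 1)%E.
  by rewrite integral_cst// mul1e; exact: probability_setT.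
by move=> ->; apply: eq_eseriesr => i _; rewrite mulr1.
Qed.

(** The existence of [b] ensures that [get] returns a sequence with the same generating function;
    the difference of the two has a power series vanishing near 0. *)
Lemma degenerate_lah_bell_eq (R : realType) (lam x : R) (b : nat -> R)
    (n : nat) :
  lah_bell_gf lam x b -> degenerate_lah_bell lam n x = b n.
Proof.
move=> gf_b; rewrite /degenerate_lah_bell.
have := getPex (ex_intro [set b | lah_bell_gf lam x b] b gf_b).
set b' := get _ => /= gf_b'.
have [r /= r0 ball_r] : \forall t \near (0 : R),
    series (fun n => (b' n - b n) / n`!%:R * t ^+ n) @ \oo --> (0 : R).
  move: gf_b gf_b'; apply: filterS2 => t cvg_b cvg_b'.
  rewrite -(subrr ((degenerate_exp lam 1 x)^-1 *
                   degenerate_exp lam 1 (x / (1 - t)))).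
  rewrite (_ : series _ = series (fun n => b' n * (t ^+ n / n`!%:R)) \-
                          series (fun n => b n * (t ^+ n / n`!%:R))).
    exact: cvgB cvg_b' cvg_b.
  apply/funext => N; rewrite /series/= -sumrB; apply: eq_bigr => k _.
  by rewrite -mulrBl mulrCA mulrC.
have d0 : (b' n - b n) / n`!%:R = 0.
  (* Halving [r] puts the closed range of [t] inside the open ball. *)
  apply: (@power_series_eq0 _ (fun n => (b' n - b n) / n`!%:R) (r / 2)).
    by rewrite divr_gt0.
  move=> t /andP[t0 tr]; apply: ball_r => /=.
  rewrite sub0r normrN gtr0_norm//; lra.
apply/eqP; rewrite -subr_eq0; apply/eqP; move: d0 => /eqP.
rewrite mulf_eq0 invr_eq0 pnatr_eq0 -[n`! == _]negbK -lt0n fact_gt0 orbF.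
by move/eqP.
Qed.

Theorem theorem5 (R : realType) (d : measure_display) (T : measurableType d)
    (P : probability T R) (lam alpha : R) (X : {RV P >-> nat})
    (halpha : 0 < alpha) (hX : degenerate_poisson lam alpha X) (n : nat) :
  ('E_P[(fun w : T => rising_binomial ((X w)%:R : R) n)])%E =
  ((n`!%:R)^-1 * degenerate_lah_bell lam n alpha)%:E.
Proof.
pose a := degenerate_exp_term lam alpha.
pose c := (degenerate_exp lam 1 alpha)^-1.
pose p i := c * a i.
have pX i : P (X @^-1` [set i]) = (p i)%:E.
  by rewrite hX -mulrA [_ / _ * _]mulrC.
have p_ge0 := nat_rv_prob_ge0 pX.
have p_sum := nat_rv_prob_sum pX.
have a0 : a 0%N = 1.
  by rewrite /a /degenerate_exp_term /lambda_ffact big_ord0 expr0 !mul1r invr1.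
(* The sign comes from the law, since convergence of the series behind [degenerate_exp] is not yet
   known: [p 0 = c], and [c = 0] would give total mass 0. *)
have c_gt0 : 0 < c.
  rewrite lt_neqAle; apply/andP; split; last first.
    by have := p_ge0 0%N; rewrite /p a0 mulr1.
  apply/eqP => c0; move: p_sum; rewrite eseries0 => [/eqP|i _ _].
    by rewrite eq_sym onee_eq0.
  by rewrite /p -c0 mul0r.
have a_ge0 i : 0 <= a i by have := p_ge0 i; rewrite pmulr_rge0.
have cvg_a : cvgn (series a).
  have : cvgn (series p) by apply: nnseries_is_cvg => //; rewrite p_sum ltry.
  move/(is_cvg_seriesZ (k := c^-1)).
  rewrite (_ : c^-1 *: p = a)//; apply/funext => i.
  by rewrite /p /= -[LHS]/(c^-1 * (c * a i)) mulKf// gt_eqF.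
have [r r01 cvg_ar] := degenerate_exp_term_summable halpha a_ge0 cvg_a.
have /andP[r0 r1] := r01.
have scale t :
    (fun i => p i * (1 - t) ^- i) = (fun i => c * (a i * (1 - t) ^- i)).
  by apply/funext => i; rewrite mulrA.
have cvg_pr : cvgn (series (fun i => p i * (1 - r) ^- i)).
  by rewrite scale; exact: is_cvg_seriesZ.
pose b k := k`!%:R * rising_binomial_moment p k.
have fact_neq0 k : k`!%:R != 0 :> R by rewrite pnatr_eq0 -lt0n fact_gt0.
have gf_b : lah_bell_gf lam alpha b.
  exists r => //= t; rewrite /ball_/= sub0r normrN => /ltW tr.
  (* The weight [(1 - t) ^- k] is absorbed into the power of [alpha], giving the terms at
     [alpha / (1 - t)]. *)
  have lim_t : limn (series (fun i => p i * (1 - t) ^- i)) =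
      c * degenerate_exp lam 1 (alpha / (1 - t)).
    rewrite scale.
    apply: etrans (lim_seriesZ c (geometric_weight_cvg a_ge0 r1 tr cvg_ar)) _.
    rewrite /degenerate_exp (_ : (fun k => lambda_ffact lam 1 k * _) =
      (fun k => a k * (1 - t) ^- k))//; apply/funext => k.
    by rewrite /a /degenerate_exp_term exprMn exprVn; ring.
  have := rising_binomial_moment_gf pX r01 tr cvg_pr; rewrite lim_t.
  rewrite (_ : (fun n => _) = (fun n => b n * (t ^+ n / n`!%:R)))//.
  by apply/funext => k; rewrite /b; field.
rewrite (degenerate_lah_bell_eq n gf_b) unlock.
rewrite (integral_rising_binomial pX n r01 cvg_pr).
by rewrite /b mulKf.
Qed.
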